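(* Let $n\ge 1$ and $k\ge 1$, let $L_1,\dots,L_k$ be lattices in $\mathbb{C}((t))^n$ that all lie in the same apartment, and let $i_1,\dots,i_k$ be nonnegative integers with $i_1+\cdots+i_k=n$. Then there exists a lattice $P$ in $\mathbb{C}((t))^n$ such that $$f^t_{i_1,\dots,i_k}(L_1,\dots,L_k)=\sum_{j=1}^{k} f^t_{i_j,\,n-i_j}(L_j,P)-(k-1)\,f^t_n(P).$$
   Context: A lattice in $\mathbb{C}((t))^n$ is a $\mathbb{C}[[t]]$-submodule of $\mathbb{C}((t))^n$ generated by $n$ vectors that are linearly independent over $\mathbb{C}((t))$. For $x=\sum_m a_m t^m\in\mathbb{C}((t))$ nonzero, $\operatorname{val}(x)$ is the smallest $m$ with $a_m\neq 0$, and $\operatorname{val}(0)=+\infty$. For a basis $x_1,\dots,x_n$ of $\mathbb{C}((t))^n$ over $\mathbb{C}((t))$, the associated apartment is the set of all lattices generated over $\mathbb{C}[[t]]$ by $t^{c_1}x_1,\dots,t^{c_n}x_n$ with $c_1,\dots,c_n\in\mathbb{Z}$. Lattices lie in the same apartment if they all belong to the apartment associated to one common basis. For nonnegative integers $i_1,\dots,i_r$ with $i_1+\cdots+i_r=n$ and lattices $L_1,\dots,L_r$ in $\mathbb{C}((t))^n$, the determinantal valuation is $$f^t_{i_1,\dots,i_r}(L_1,\dots,L_r)=\max\bigl(-\operatorname{val}\det(v_{11},\dots,v_{1i_1},v_{21},\dots,v_{2i_2},\dots,v_{r1},\dots,v_{ri_r})\bigr),$$ where the maximum is over all choices of vectors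 $v_{ab}\in L_a$ ($1\le a\le r$, $1\le b\le i_a$; no vectors are taken from $L_a$ if $i_a=0$). In particular $f^t_n(P)$ (the case $r=1$) is the maximum of $-\operatorname{val}\det(v_1,\dots,v_n)$ over $v_1,\dots,v_n\in P$. *)

(* Defs.v *)
From HB Require Import structures.
From mathcomp Require Import all_boot all_order all_algebra.
From mathcomp Require Import perm zify.
From mathcomp Require Import boolp classical_sets functions cardinality fsbigop.
From mathcomp Require Import constructive_ereal reals.
From mathcomp.real_closed Require Import complex.

Set Implicit Arguments.
Unset Strict Implicit.
Unset Printing Implicit Defensive.

Import Order.TTheory GRing.Theory Num.Theory.

Local Open Scope classical_set_scope.
Local Open Scope ring_scope.

Section Laurent.
Variable F : fieldType.

Definition bounded_below (a : int -> F) : Prop :=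
  exists N : int, forall m, m < N -> a m = 0.

Record laurent := Laurent {
  lcoef :> int -> F;
  lcoefP : bounded_below lcoef
}.

HB.instance Definition _ := gen_eqMixin laurent.
HB.instance Definition _ := gen_choiceMixin laurent.

Lemma laurentP (x y : laurent) : (forall m, x m = y m) -> x = y.
Proof.
case: x y => [a ha] [b hb] /= /funext e; move: hb; rewrite -e => hb.
by congr Laurent; exact: Prop_irrelevance.
Qed.

(* Internal presentation of Laurent series as t^N * (power series), used only
   to derive the field axioms. *)
Local Definition shift (N : int) (p : nat -> F) (m : int) : F :=
  if m - N is Posz k then p k else 0.

Local Lemma shift_bounded N p : bounded_below (shift N p).
Proof.
by exists N => m mN; rewrite /shift; case E: (m - N) => [k|//]; exfalso; lia.
Qed.

Local Lemma shiftE N p (k : nat) : shift N p (N + k%:Z) = p k.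
Proof. by rewrite /shift addrAC subrr add0r. Qed.

Local Lemma shift_lt N p m : m < N -> shift N p m = 0.
Proof. by move=> mN; rewrite /shift; case E: (m - N) => [k|//]; exfalso; lia. Qed.

Local Lemma exists_shift (a : int -> F) : bounded_below a ->
  exists N, forall M, M <= N -> exists p, a = shift M p.
Proof.
move=> [N aN]; exists N => M MN; exists (fun k => a (M + k%:Z)).
apply/funext => m; have [/[dup] mM /shift_lt->|Mm] := ltP m M.
  by rewrite aN// (lt_le_trans mM).
by have [k ->] : exists k : nat, m = M + k%:Z; [exists (absz (m - M)); lia|rewrite shiftE].
Qed.

Local Definition pmul (p q : nat -> F) (n : nat) : F := \sum_(i < n.+1) p i * q (n - i)%N.

Local Definition conv (a b : int -> F) (m : int) : F := \sum_(i \in [set: int]) a i * b (m - i).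

Local Lemma convE N M p q : conv (shift N p) (shift M q) = shift (N + M) (pmul p q).
Proof.
apply/funext => m; rewrite /conv; have [mNM|NMm] := ltP m (N + M).
  rewrite shift_lt// fsbig1// => i _.
  have [/shift_lt->|Ni] := ltP i N; first by rewrite mul0r.
  by rewrite (@shift_lt M) ?mulr0//; lia.
have [k ->] : exists k : nat, m = N + M + k%:Z by exists (absz (m - (N + M))%R); lia.
rewrite shiftE /pmul (@fsbig_ord _ _ _ k.+1 (fun i => p i * q (k - i)%N)).
pose h (i : nat) : int := N + i%:Z.
rewrite -(fsbig_widen (h @` `I_k.+1)) //=; last first.
  move=> i [_ /= hi]; have [/shift_lt->|Ni] := ltP i N; first by rewrite mul0r.
  rewrite (@shift_lt M) ?mulr0//; rewrite ltNge; apply/negP => le.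
  by apply: hi; exists (absz (i - N)); rewrite /h /=; lia.
rewrite fsbig_image; last by move=> i j _ _; rewrite /h; lia.
apply: eq_fsbigr => i; rewrite inE /= => ik; rewrite /h shiftE.
by congr (_ * _); rewrite -[RHS](shiftE M); congr shift; lia.
Qed.

Local Lemma conv_bounded (x y : laurent) : bounded_below (conv x y).
Proof.
have [N hN] := exists_shift (lcoefP x); have [M hM] := exists_shift (lcoefP y).
have [p ->] := hN _ (lexx _); have [q ->] := hM _ (lexx _).
by rewrite convE; exact: shift_bounded.
Qed.

Local Lemma delta_bounded (n : int) : bounded_below (fun m => (m == n)%:R).
Proof. by exists n => m; rewrite lt_neqAle => /andP[/negbTE->]. Qed.

Local Lemma zero_bounded : bounded_below (fun=> 0). Proof. by exists 0. Qed.

Local Lemma opp_bounded (x : laurent) : bounded_below (fun m => - x m).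
Proof. by have [N xN] := lcoefP x; exists N => m /xN ->; rewrite oppr0. Qed.

Local Lemma add_bounded (x y : laurent) : bounded_below (fun m => x m + y m).
Proof.
have [N xN] := lcoefP x; have [M yM] := lcoefP y; exists (Num.min N M) => m.
by rewrite lt_min => /andP[/xN-> /yM->]; rewrite addr0.
Qed.

Definition laurent_zero : laurent := Laurent zero_bounded.
Definition laurent_opp (x : laurent) : laurent := Laurent (opp_bounded x).
Definition laurent_add (x y : laurent) : laurent := Laurent (add_bounded x y).

Definition laurent_monomial (n : int) : laurent := Laurent (delta_bounded n).

(* Only finitely many terms of the sum are nonzero, x and y being bounded
   below, so it is a genuine sum and not the default value 0 of fsbigop. *)
Definition laurent_mul (x y : laurent) : laurent :=
  @Laurent (fun m => \sum_(i \in [set: int]) x i * y (m - i)) (conv_bounded x y).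

Local Lemma addA : associative laurent_add.
Proof. by move=> x y z; apply: laurentP => m /=; rewrite addrA. Qed.
Local Lemma addC : commutative laurent_add.
Proof. by move=> x y; apply: laurentP => m /=; rewrite addrC. Qed.
Local Lemma add0 : left_id laurent_zero laurent_add.
Proof. by move=> x; apply: laurentP => m /=; rewrite add0r. Qed.
Local Lemma addN : left_inverse laurent_zero laurent_opp laurent_add.
Proof. by move=> x; apply: laurentP => m /=; rewrite addNr. Qed.

HB.instance Definition _ := GRing.isZmodule.Build laurent addA addC add0 addN.

Local Definition Shift N p : laurent := Laurent (shift_bounded N p).

Local Lemma ShiftP (x : laurent) : exists N, forall M, M <= N -> exists p, x = Shift M p.
Proof.
have [N hN] := exists_shift (lcoefP x); exists N => M /hN [p xp].
by exists p; apply: laurentP => m /=; rewrite -xp.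
Qed.

Local Lemma Shift_mul N M p q :
  laurent_mul (Shift N p) (Shift M q) = Shift (N + M) (pmul p q).
Proof. by apply: laurentP => m /=; rewrite -convE. Qed.

Local Lemma Shift_add N p q :
  Shift N p + Shift N q = Shift N (fun i => p i + q i).
Proof. by apply: laurentP => m /=; rewrite /shift; case: (m - N) => // k; rewrite addr0. Qed.

Local Lemma pmulE p q n K : (n < K)%N ->
  pmul p q n = ((\poly_(i < K) p i) * (\poly_(i < K) q i))`_n.
Proof.
move=> nK; rewrite coefM; apply: eq_bigr => i _; rewrite !coef_poly.
by rewrite !ifT//; have := ltn_ord i; lia.
Qed.

Local Lemma pmulA p q r : pmul p (pmul q r) = pmul (pmul p q) r.
Proof.
apply/funext => n; pose P s := \poly_(i < n.+1) (s i : F).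
transitivity ((P p * (P q * P r))`_n).
  rewrite coefM; apply: eq_bigr => i _; rewrite coef_poly ltn_ord.
  by rewrite (@pmulE _ _ _ n.+1)//; lia.
rewrite mulrA coefM; apply: eq_bigr => i _; rewrite coef_poly ifT; last by lia.
by rewrite (@pmulE _ _ _ n.+1).
Qed.

Local Lemma pmulC p q : pmul p q = pmul q p.
Proof. by apply/funext => n; rewrite !(@pmulE _ _ _ n.+1)// mulrC. Qed.

Local Lemma pmulDl p q r : pmul (fun i => p i + q i) r = (fun i => pmul p r i + pmul q r i).
Proof.
by apply/funext => n; rewrite -big_split; apply: eq_bigr => i _; rewrite mulrDl.
Qed.

Local Definition pone (n : nat) : F := (n == 0%N)%:R.

Local Lemma pmul1 p : pmul pone p = p.
Proof.
apply/funext => n; rewrite /pmul big_ord_recl /pone /= mul1r subn0 big1 ?addr0//.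
by move=> i _; rewrite mul0r.
Qed.

Local Lemma ShiftP1 (x : laurent) : exists N p, x = Shift N p.
Proof. by have [N hN] := ShiftP x; exists N; exact: hN. Qed.

Local Lemma mulA : associative laurent_mul.
Proof.
move=> x y z; have [N [p ->]] := ShiftP1 x; have [M [q ->]] := ShiftP1 y.
by have [K [r ->]] := ShiftP1 z; rewrite !Shift_mul pmulA addrA.
Qed.

Local Lemma mulC : commutative laurent_mul.
Proof.
move=> x y; have [N [p ->]] := ShiftP1 x; have [M [q ->]] := ShiftP1 y.
by rewrite !Shift_mul pmulC addrC.
Qed.

Local Lemma Shift1 : laurent_monomial 0 = Shift 0 pone.
Proof. by apply: laurentP => m /=; rewrite /shift subr0 /pone; case: m. Qed.

Local Lemma mul1 : left_id (laurent_monomial 0) laurent_mul.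
Proof.
by move=> x; have [N [p ->]] := ShiftP1 x; rewrite Shift1 Shift_mul pmul1 add0r.
Qed.

Local Lemma mulDl : left_distributive laurent_mul +%R.
Proof.
move=> x y z; have [N hN] := ShiftP x; have [M hM] := ShiftP y.
have [K [r ->]] := ShiftP1 z.
have [p ->] := hN (Num.min N M) (ltac:(by rewrite ge_min lexx)).
have [q ->] := hM (Num.min N M) (ltac:(by rewrite ge_min lexx orbT)).
by rewrite Shift_add !Shift_mul Shift_add pmulDl.
Qed.

Local Lemma one_neq0 : laurent_monomial 0 != 0.
Proof.
by apply/eqP => /(congr1 (fun x : laurent => x 0)) /= /eqP; rewrite oner_eq0.
Qed.

HB.instance Definition _ := GRing.Zmodule_isComNzRing.Build laurent
  mulA mulC mul1 mulDl one_neq0.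

Local Fixpoint pinv_seq (p : nat -> F) (n : nat) : seq F :=
  if n is n'.+1 then let s := pinv_seq p n' in
    rcons s ((p 0%N)^-1 * (pone n' - \sum_(i < n') p i.+1 * s`_(n' - i.+1)))
  else [::].

Local Definition pinv p n := (pinv_seq p n.+1)`_n.

Local Lemma size_pinv p n : size (pinv_seq p n) = n.
Proof. by elim: n => //= n IH; rewrite size_rcons IH. Qed.

Local Lemma nth_pinv p n i : (i < n)%N -> (pinv_seq p n)`_i = pinv p i.
Proof.
elim: n => // n IH; rewrite ltnS leq_eqVlt => /predU1P[->//|lt_in].
by rewrite /= nth_rcons size_pinv lt_in IH.
Qed.

Local Lemma pmulV p : p 0%N != 0 -> pmul p (pinv p) = pone.
Proof.
move=> p0; apply/funext => n; rewrite /pmul big_ord_recl subn0 {1}/pinv /=.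
rewrite nth_rcons size_pinv ltnn eqxx mulVKf// -addrA [X in _ + X]addrC.
apply/eqP; rewrite -subr_eq0 addrAC subrr add0r subr_eq0; apply/eqP.
by apply: eq_bigr => i _; rewrite nth_pinv//; have := ltn_ord i; lia.
Qed.

Local Lemma least_coef (x : laurent) : x != 0 ->
  exists m, x m != 0 /\ forall l, x l != 0 -> m <= l.
Proof.
move=> x0; have [N [p xE]] := ShiftP1 x.
have : exists k, p k != 0.
  apply: contrapT => /forallNP p0; move/eqP: x0; apply; rewrite xE.
  apply: laurentP => m /=; rewrite /shift; case: (m - N) => // k.
  by apply/eqP; rewrite -[_ == _]negbK; apply/negP/p0.
move=> ex; have [k pk kmin] := ex_minnP ex; exists (N + k%:Z).
rewrite xE; split=> [|l]; first by rewrite /= shiftE.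
have [lN|Nl] := ltP l N; first by rewrite /= shift_lt// eqxx.
have -> : l = N + (absz (l - N))%:Z by lia.
by rewrite /= shiftE => /kmin; lia.
Qed.

Local Lemma ex_inv (x : laurent) : x != 0 -> exists y, y * x = 1.
Proof.
move=> /least_coef[m [xm mmin]].
have {mmin} xlt l : l < m -> x l = 0.
  by move=> lm; apply/eqP/negPn/negP => /mmin; rewrite leNgt lm.
have xE : x = Shift m (fun k => x (m + k%:Z)).
  apply: laurentP => l /=; have [/[dup] lm /shift_lt->|ml] := ltP l m.
    exact: xlt.
  by have -> : l = m + (absz (l - m))%:Z; [lia|rewrite shiftE].
set p := fun k => _ in xE.
exists (Shift (- m) (pinv p)); rewrite mulrC {1}xE.
rewrite [LHS]Shift_mul addrN pmulV; first by rewrite -Shift1.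
by rewrite /p addr0.
Qed.

Definition laurent_inv (x : laurent) : laurent :=
  if x == 0 then 0 else xget 0 [set y | y * x = 1].

Local Lemma mulV (x : laurent) : x != 0 -> laurent_inv x * x = 1.
Proof.
by move=> x0; rewrite /laurent_inv (negbTE x0); apply: (xgetPex 0 (ex_inv x0)).
Qed.

Local Lemma inv0 : laurent_inv 0 = 0. Proof. by rewrite /laurent_inv eqxx. Qed.

HB.instance Definition _ := GRing.ComNzRing_isField.Build laurent mulV inv0.

Definition is_order (x : laurent) (m : int) : Prop :=
  x m != 0 /\ forall l, x l != 0 -> m <= l.

Definition lval (x : laurent) : \bar int :=
  if x == 0 then +oo%E else (xget 0 (is_order x))%:E.

Local Lemma lval0 : lval 0 = +oo%E. Proof. by rewrite /lval eqxx. Qed.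

Lemma lvalP (x : laurent) : x != 0 -> exists2 m, lval x = m%:E & is_order x m.
Proof.
move=> x0; rewrite /lval (negbTE x0); eexists; first by [].
exact: xgetPex (least_coef x0).
Qed.

(* The subring F[[t]] of F((t)). *)
Definition integral : set laurent := [set x | forall m, m < 0 -> x m = 0].

Local Definition vge (N : int) (x : laurent) := forall m, m < N -> x m = 0.

Local Lemma vgeW N M x : M <= N -> vge N x -> vge M x.
Proof. by move=> MN xN m mM; apply: xN; exact: lt_le_trans mM MN. Qed.

Local Lemma vge_add N x y : vge N x -> vge N y -> vge N (x + y).
Proof. by move=> xN yN m mN; rewrite [LHS]/= xN// yN// addr0. Qed.

Local Lemma vge_opp N x : vge N x -> vge N (- x).
Proof. by move=> xN m mN; rewrite [LHS]/= xN// oppr0. Qed.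

Local Lemma vge_mul N M x y : vge N x -> vge M y -> vge (N + M) (x * y).
Proof.
move=> xN yM m mNM; rewrite [LHS]/= fsbig1// => i _.
have [/xN->|Ni] := ltP i N; first by rewrite mul0r.
by rewrite yM ?mulr0//; lia.
Qed.

Local Lemma vge_monomial N : vge N (laurent_monomial N).
Proof. by move=> m mN; rewrite /= (lt_eqF mN). Qed.

Local Lemma vge_sum (I : Type) (r : seq I) (P : pred I) (f : I -> laurent) N :
  (forall i, P i -> vge N (f i)) -> vge N (\sum_(i <- r | P i) f i).
Proof. by move=> fN; elim/big_ind : _ => // x y; exact: vge_add. Qed.

Local Lemma vge_det N n (A : 'M[laurent]_n) :
  (forall i j, vge N (A i j)) -> vge (N *+ n) (\det A).
Proof.
move=> AN; apply: vge_sum => s _.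
have h : vge (N *+ n) (\prod_i A i (s i)).
  rewrite -[n in N *+ n]card_ord -sumr_const.
  elim/big_rec2 : _ => [|i x N' _ h]; first exact: vge_monomial.
  exact: vge_mul.
by case: (odd_perm s); rewrite ?expr1 ?mulN1r ?expr0 ?mul1r//; exact: vge_opp.
Qed.

Local Lemma vge_lval N x : vge N x -> (- lval x <= (- N)%:E)%E.
Proof.
move=> xN; have [->|/lvalP[m -> [xm _]]] := eqVneq x 0; first by rewrite lval0 leNye.
rewrite -EFinN lee_fin lerN2 leNgt; apply/negP => /xN x0.
by rewrite x0 eqxx in xm.
Qed.

Local Lemma monomial_neq0 N : laurent_monomial N != 0.
Proof.
by apply/eqP => /(congr1 (fun x : laurent => x N)) /= /eqP; rewrite eqxx oner_eq0.
Qed.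

End Laurent.

Local Lemma common_bound (T : finType) (P : T -> int -> Prop) :
  (forall a N M, M <= N -> P a N -> P a M) -> (forall a, exists N, P a N) ->
  exists N, forall a, P a N.
Proof.
move=> Pmono /choice[f Pf]; exists (- \sum_a `|f a|) => a.
apply: Pmono (Pf a); rewrite (bigD1 a)//=.
have : 0 <= \sum_(i | i != a) `|f i| by apply: sumr_ge0.
have := ler_norm (- f a); rewrite normrN.
move: `|f a| (\sum_(i | _) _) => u w; lia.
Qed.

Section Lattices.
Variables (F : fieldType) (n : nat).
Local Notation K := (laurent F).

(* Vectors of F((t))^n are row vectors; a family of n of them is encoded as
   the rows of a square matrix, here generating an F[[t]]-submodule. *)
Definition integral_span (B : 'M[K]_n) : set 'rV[K]_n :=
  [set v | exists2 c : 'I_n -> K,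
     (forall i, integral (c i)) & v = \sum_i c i *: row i B].

Definition is_lattice (L : set 'rV[K]_n) : Prop :=
  exists2 B : 'M[K]_n, row_free B & L = integral_span B.

Definition apartment (X : 'M[K]_n) : set (set 'rV[K]_n) :=
  [set L | exists c : 'I_n -> int,
     L = integral_span (\matrix_i (laurent_monomial F (c i) *: row i X))].

Definition same_apartment (k : nat) (L : k.-tuple (set 'rV[K]_n)) : Prop :=
  exists2 X : 'M[K]_n, row_free X & forall j, apartment X (tnth L j).

(* All - val det(v_11, ..., v_1i_1, ..., v_r1, ..., v_ri_r) with v_ab in L_a;
   the vectors v_ab, for fixed a, are the rows of V a. *)
Definition det_values (r : nat) (i : r.-tuple nat) (L : r.-tuple (set 'rV[K]_n)) :
    set (\bar int) :=
  [set x | exists (e : (\sum_(a < r) tnth i a = n)%N)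
                  (V : forall a : 'I_r, 'M[K]_(tnth i a, n)),
     (forall a b, tnth L a (row b (V a))) /\
     x = (- lval (\det (castmx (e, erefl n) (\mxcol_(a < r) V a))))%E].

Definition is_maximum (A : set (\bar int)) (m : \bar int) : Prop :=
  A m /\ forall x, A x -> (x <= m)%E.

(* det_valuation_max below shows that the maximum exists, as an integer,
   whenever the i_a add up to n and the L_a are lattices. *)
Definition det_valuation (r : nat) (i : r.-tuple nat)
    (L : r.-tuple (set 'rV[K]_n)) : int :=
  xget 0 [set m : int | is_maximum (det_values i L) m%:E].

Local Lemma lattice_vge (L : set 'rV[K]_n) : is_lattice L ->
  exists N, forall v, L v -> forall j, vge N (v 0 j).
Proof.
move=> [B _ ->].
have [N hN] : exists N, forall ij : 'I_n * 'I_n, vge N (B ij.1 ij.2).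
  apply: common_bound => [a N M|[i j]]; first exact: vgeW.
  exact: lcoefP.
exists N => v [c c0 ->] j; rewrite summxE; apply: vge_sum => i _.
by rewrite !mxE -[N]add0r; apply: vge_mul (c0 i) (hN (i, j)).
Qed.

Local Lemma lattice_std (L : set 'rV[K]_n) : is_lattice L ->
  exists N : int, forall M : int, M <= N ->
    forall j, L (row j (laurent_monomial F (- M))%:M).
Proof.
move=> [B fB ->].
have [N hN] : exists N, forall ij : 'I_n * 'I_n, vge N (invmx B ij.1 ij.2).
  apply: common_bound => [a N M|[i j]]; first exact: vgeW.
  exact: lcoefP.
exists N => M MN j; exists (fun i => laurent_monomial F (- M) * invmx B j i).
  move=> i; have := vge_mul (@vge_monomial F (- M)) (hN (j, i)).
  by apply: vgeW; lia.
have uB : B \in unitmx by rewrite -row_free_unit.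
transitivity (laurent_monomial F (- M) *: (row j (invmx B) *m B)).
  by rewrite -row_mul mulVmx//; apply/rowP => k; rewrite !mxE mulr_natr.
rewrite mulmx_sum_row scaler_sumr; apply: eq_bigr => i _.
by rewrite scalerA mxE.
Qed.

Lemma det_valuation_max (r : nat) (i : r.-tuple nat)
    (L : r.-tuple (set 'rV[K]_n)) :
  (\sum_(a < r) tnth i a = n)%N -> (forall a, is_lattice (tnth L a)) ->
  is_maximum (det_values i L) (det_valuation i L)%:E.
Proof.
move=> e latL.
have [U hU] : exists U, forall a, forall v, tnth L a v -> forall j, vge U (v 0 j).
  apply: common_bound => [a N M MN h v Lv j|a]; last exact: lattice_vge.
  by apply: vgeW (h v Lv j).
have [N hN] : exists N : int, forall a, forall M : int, M <= N ->
    forall j, tnth L a (row j (laurent_monomial F (- M))%:M).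
  apply: common_bound => [a N M MN h M' M'M j|a]; last exact: lattice_std.
  by apply: h; exact: le_trans MN.
have ub x : det_values i L x -> (x <= (- (U *+ n))%:E)%E.
  move=> [e' [V [LV ->]]]; apply/vge_lval/vge_det => k j.
  rewrite castmxE mxE /= cast_ord_id.
  set a := tagnat.sig1 _; set b := tagnat.sig2 _.
  by have := hU a _ (LV a b) j; rewrite mxE.
have [m Am] : exists m : int, det_values i L m%:E.
  pose S : 'M[K]_n := (laurent_monomial F (- N))%:M.
  have : \det S != 0 by rewrite det_scalar expf_neq0// monomial_neq0.
  move=> /lvalP[m mE _]; exists (- m); exists e.
  exists (fun a => submxcol (castmx (esym e, erefl n) S) a); split.
    move=> a b; have := hN a N (lexx _) (cast_ord e (tagnat.Rank a b)).
    by congr (tnth L a _); apply/rowP => j; rewrite !mxE castmxE /= cast_ord_id esymK mxE.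
  by rewrite submxcolK castmxKV mE.
have : exists m : int, is_maximum (det_values i L) m%:E.
  pose B : int := - (U *+ n).
  have mB k : det_values i L k%:E -> k <= B by move=> /ub; rewrite lee_fin.
  have ex : exists k : nat, `[< det_values i L (B - k%:Z)%:E >].
    exists (absz (B - m)); apply/asboolP; have := mB _ Am => le_mB.
    by have -> : B - (absz (B - m)%R)%:Z = m by lia.
  have [k /asboolP Ak kmin] := ex_minnP ex; exists (B - k%:Z); split=> // x Ax.
  case: x Ax (ub _ Ax) => [l Al _|_|_ _] //.
    rewrite lee_fin; have lB := mB _ Al.
    have := kmin (absz (B - l)); rewrite (_ : B - (absz (B - l)%R)%:Z = l); last by lia.
    by move=> /(_ (asboolT Al)); lia.
  by rewrite leNye.
exact: xgetPex.
Qed.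

End Lattices.

(* Main.v *)
Require Import Defs.
From mathcomp Require Import all_boot all_order all_algebra.
From mathcomp Require Import perm zify ring.
From mathcomp Require Import boolp classical_sets reals.
From mathcomp Require Import fsbigop constructive_ereal.
From mathcomp.real_closed Require Import complex.

Set Implicit Arguments.
Unset Strict Implicit.
Unset Printing Implicit Defensive.
Import Order.TTheory GRing.Theory Num.Theory.

Local Open Scope classical_set_scope.
Local Open Scope ring_scope.

(** In an apartment with basis [X] and [L_a] spanned by the [t^(c a s) X_s], the
    determinantal valuation is [- val (det X)] minus the least cost
    [\sum_s c (tau s) s] of an assignment [tau] of the indices [s] to the
    lattices [a] with prescribed fiber sizes [i_a]. For a cheapest [tau], the
    graph with edge weights [c (tau s) s - c (tau r) s] has no cycle of positive
    weight, so it has an integer potential [v], namely an optimal solution of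
    the dual transportation problem. The lattice [P] spanned by the
    [t^(c (tau s) s + v s) X_s] then works: for every [j], the fiber of [tau]
    over [j] is a cheapest choice for the pair [(L_j, P)], and the resulting
    costs add up to the cost of [tau]. *)

Lemma int_max_exists (A : int -> Prop) (B : int) :
  (exists m, A m) -> (forall m, A m -> m <= B) ->
  exists2 m, A m & forall l, A l -> l <= m.
Proof.
move=> [m Am] AB.
have ex : exists k : nat, `[< A (B - k%:Z) >].
  exists (absz (B - m)); apply/asboolP; have := AB _ Am => mB.
  by have -> : B - (absz (B - m)%R)%:Z = m by lia.
have [k /asboolP Ak kmin] := ex_minnP ex; exists (B - k%:Z) => // l Al.
have lB := AB _ Al; have := kmin (absz (B - l)).
rewrite (_ : B - (absz (B - l)%R)%:Z = l); last by lia.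
by move=> /(_ (asboolT Al)); lia.
Qed.

(** * Integer potentials on weighted digraphs without positive cycles *)

Section Potential.
Variables (T : finType) (w : T -> T -> int).

Fixpoint walk_weight (x : T) (p : seq T) : int :=
  if p is y :: p' then w x y + walk_weight y p' else 0.

Lemma walk_weight_cat x p q :
  walk_weight x (p ++ q) = walk_weight x p + walk_weight (last x p) q.
Proof. by elim: p x => [|y p IH] x /=; rewrite ?add0r// IH addrA. Qed.

Lemma walk_weight_nth z x p :
  walk_weight x p = \sum_(0 <= i < size p) w (nth z (x :: p) i) (nth z p i).
Proof.
elim: p x => [|y p IH] x /=; first by rewrite big_nil.
by rewrite big_nat_recl//= IH.
Qed.

Lemma walk_weight_next x q : uniq (x :: q) ->
  walk_weight x (rcons q x) = \sum_(s <- x :: q) w s (next (x :: q) s).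
Proof.
move=> Uq; rewrite (walk_weight_nth x) (big_nth x) size_rcons.
apply: eq_big_nat => i /andP[_ iq].
rewrite next_nth mem_nth// index_uniq// -rcons_cons !nth_rcons /= iq.
(* At the last vertex [nth] returns its default [x], which closes the cycle. *)
by case: ltnP => // qi; rewrite if_same (nth_default _ qi).
Qed.

Hypothesis w_diag : forall s, w s s = 0.
Hypothesis w_perm : forall pi : {perm T}, \sum_s w s (pi s) <= 0.

(** A simple cycle extends by fixed points to a permutation; the fixed points weigh 0 by [w_diag],
    so [w_perm] gives the bound. *)
Lemma simple_cycle_weight x q : uniq (x :: q) -> walk_weight x (rcons q x) <= 0.
Proof.
move=> Uq; rewrite walk_weight_next// big_uniq//.
pose pi := perm (can_inj (prev_next Uq)).
have piE s : pi s = next (x :: q) s by rewrite permE.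
have := w_perm pi; rewrite (bigID (mem (x :: q))) /= [X in _ + X]big1 ?addr0; last first.
  by move=> s sq; rewrite piE next_nth (negbTE sq) w_diag.
by under eq_bigr do rewrite piE.
Qed.

(** Cutting out a cycle cannot lower the weight, since cycles have weight at most 0. *)
Lemma simple_walk_heavier x p : exists p',
  [/\ uniq (x :: p'), last x p' = last x p & walk_weight x p <= walk_weight x p'].
Proof.
elim: p x => [|y p IH] x; first by exists [::].
have [p' [Up' lp' wp']] := IH y.
have [xp'|xp'] := boolP (x \in y :: p'); last first.
  by exists (y :: p'); rewrite cons_uniq xp' Up' /= lp' lerD2l.
(* If the simple walk [p'] from [y] returns to [x], the part [q] before that visit forms a simple
   cycle through [x], which is dropped. *)
have [q [p2 Eq]] : exists q p2, y :: p' = q ++ x :: p2.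
  by case/splitPr: xp' => q p2; exists q, p2.
exists p2; move: Up'; rewrite Eq cat_uniq => /and3P[Uq /hasPn xq Up2].
have Uxq : uniq (x :: q) by rewrite /= Uq andbT; apply: xq; rewrite mem_head.
split=> //=.
  by rewrite -lp' -[RHS]/(last x (y :: p')) Eq last_cat.
apply: le_trans (_ : walk_weight x (y :: p') <= _); first by rewrite /= lerD2l.
rewrite Eq -cat_rcons walk_weight_cat last_rcons gerDr.
exact: simple_cycle_weight.
Qed.

(* [v r] is the largest weight of a walk from a base point to [r]. *)
Lemma potential_exists : exists v : T -> int, forall s r, w s r <= v r - v s.
Proof.
have [x0|T0] := pickP [pred x : T | true]; last first.
  by exists (fun=> 0) => s; have := T0 s.
move=> _.
pose A r m := exists2 p, last x0 p = r & walk_weight x0 p = m.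
have Aw r : exists m, A r m by exists (walk_weight x0 [:: r]), [:: r].
(* A simple walk from [x0] to [r], closed by the edge back to [x0], is a simple cycle. *)
have Aub r m : A r m -> m <= - w r x0.
  move=> [p lp <-]; have [p' [Up' lp' le_p]] := simple_walk_heavier x0 p.
  have := simple_cycle_weight Up'.
  by rewrite -cats1 walk_weight_cat lp' lp /= addr0; lia.
have /choice[v hv] r : exists m, A r m /\ forall l, A r l -> l <= m.
  by have [m] := int_max_exists (Aw r) (@Aub r); exists m.
(* A heaviest walk to [s], extended by the edge to [r], competes for [v r]. *)
exists v => s r; have [[p lp wp] _] := hv s; have [_ /(_ (v s + w s r))] := hv r.
rewrite lerBrDl; apply; exists (rcons p r); first by rewrite last_rcons.
by rewrite -cats1 walk_weight_cat lp wp /= addr0.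
Qed.

End Potential.

(** * Orders of products of Laurent series *)

Section Order.
Variable F : fieldType.
Implicit Types x y : laurent F.

Lemma is_orderP x m : is_order x m <-> x m != 0 /\ Defs.vge m x.
Proof.
split=> -[xm h]; split=> // l.
  by move=> lm; apply/eqP/negPn/negP => /h; rewrite leNgt lm.
by apply: contraNT; rewrite -ltNge => /h ->.
Qed.

Lemma lval_order x m : is_order x m -> lval x = m%:E.
Proof.
move=> [xm hm]; have x0 : x != 0 by apply: contraNneq xm => ->.
have [l -> [xl hl]] := lvalP x0.
by congr (_%:E); apply/eqP; rewrite eq_le hl// hm.
Qed.

Lemma is_order_mul x y a b :
  is_order x a -> is_order y b -> is_order (x * y) (a + b).
Proof.
move=> /is_orderP[xa ha] /is_orderP[yb hb]; apply/is_orderP; split; last first.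
  exact: Defs.vge_mul.
(* Only the index [a] contributes to the coefficient at [a + b]. *)
rewrite [X in X != 0]/= -(fsbig_widen [set a])//=.
  by rewrite fsbig_set1 addrAC subrr add0r mulf_neq0.
move=> i [_ /= /eqP]; rewrite neq_lt => /orP[/ha->|ai]; first by rewrite mul0r.
by rewrite hb ?mulr0//; lia.
Qed.

Lemma is_order_monomial m : is_order (laurent_monomial F m) m.
Proof.
by apply/is_orderP; split; [rewrite /= eqxx oner_neq0|exact: Defs.vge_monomial].
Qed.

Lemma is_order_prod (I : Type) (r : seq I) (f : I -> laurent F) (a : I -> int) :
  (forall i, is_order (f i) (a i)) -> is_order (\prod_(i <- r) f i) (\sum_(i <- r) a i).
Proof.
move=> fa; elim/big_rec2 : _ => [|i N x _ h]; first exact: is_order_monomial.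
exact: is_order_mul.
Qed.

Lemma is_order_sign (b : bool) : is_order ((-1) ^+ b : laurent F) 0.
Proof.
have /is_orderP[h1 h2] := is_order_monomial 0.
apply/is_orderP; case: b; rewrite ?expr0// expr1; split; last exact: Defs.vge_opp.
by rewrite [X in X != 0]/= oppr_eq0.
Qed.

End Order.

(** * Determinantal valuations in an apartment as least assignment costs *)

Section Apartment.
Variables (F : fieldType) (n : nat).
Local Notation K := (laurent F).
Implicit Types X : 'M[K]_n.

Definition scaled_basis (c : 'I_n -> int) X : 'M[K]_n :=
  \matrix_i (laurent_monomial F (c i) *: row i X).

Lemma row_free_scaled_basis c X : row_free X -> row_free (scaled_basis c X).
Proof.
rewrite !row_free_unit !unitmxE !unitfE.
have -> : scaled_basis c X = diag_mx (\row_i laurent_monomial F (c i)) *m X.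
  by apply/matrixP => i j; rewrite mul_diag_mx !mxE.
rewrite det_mulmx mulf_eq0 negb_or => ->; rewrite andbT det_diag.
by apply/prodf_neq0 => i _; rewrite mxE Defs.monomial_neq0.
Qed.

(** The value tuples of [f] and [g] have the same multiplicities, so one is a rearrangement of the
    other. *)
Lemma same_fibers_perm (r : nat) (f g : 'I_n -> 'I_r) :
  (forall a, #|[set s | f s == a]%SET| = #|[set s | g s == a]%SET|) ->
  exists pi : 'S_n, forall s, f s = g (pi s).
Proof.
move=> fg; have : perm_eq [tuple f s | s < n] [tuple g s | s < n].
  have cnt (h : 'I_n -> 'I_r) a :
      count_mem a [tuple h s | s < n] = #|[set s | h s == a]%SET|.
    rewrite count_map cardE /enum_mem size_filter -enumT.
    by apply: eq_count => s; rewrite /= inE.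
  by apply/allP => a _ /=; rewrite !cnt fg.
move=> /tuple_permP[pi E]; exists pi => s.
have /(congr1 (fun t => tnth t s)) :
    [tuple f s | s < n] = [tuple tnth [tuple g s | s < n] (pi s) | s < n].
  exact: val_inj.
by rewrite !tnth_mktuple.
Qed.

Section Block.
Variables (r : nat) (i : r.-tuple nat) (e : (\sum_(a < r) tnth i a = n)%N).

(** The index of the lattice that supplies row [x] of the stacked matrix in [det_values]. *)
Definition block_of (x : 'I_n) : 'I_r := tagnat.sig1 (cast_ord (esym e) x).

Lemma block_of_Rank a (b : 'I_(tnth i a)) :
  block_of (cast_ord e (tagnat.Rank a b)) = a.
Proof. by rewrite /block_of cast_ordK tagnat.Rank1K. Qed.

Lemma card_block a : #|[set x | block_of x == a]%SET| = tnth i a.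
Proof.
have -> : [set x | block_of x == a]%SET =
    [set cast_ord e (tagnat.Rank a b) | b : 'I_(tnth i a)]%SET.
  apply/setP => x; rewrite inE; apply/eqP/imsetP => [|[b _ ->]]; last first.
    exact: block_of_Rank.
  move=> <-; exists (tagnat.sig2 (cast_ord (esym e) x)) => //.
  by rewrite tagnat.sig2K cast_ordKV.
rewrite card_imset ?card_ord// => b b' /cast_ord_inj /(congr1 (@nat_of_ord _)).
by rewrite !tagnat.RankEsum => /addnI /val_inj.
Qed.

End Block.

Variables (X : 'M[K]_n) (m : int).
Hypothesis X_order : is_order (\det X) m.

(** Each permutation in the Leibniz expansion of the coordinate matrix induces an admissible
    assignment, so every term has order at least the least cost. Rows that are scaled basis vectors,
    distributed according to [tau], attain it; [m] comes from [\det X]. *)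
Lemma det_valuation_assignment (r : nat) (i : r.-tuple nat)
    (L : r.-tuple (set 'rV[K]_n)) (c : 'I_r -> 'I_n -> int) (tau : 'I_n -> 'I_r) :
  (\sum_(a < r) tnth i a = n)%N ->
  (forall a, tnth L a = integral_span (scaled_basis (c a) X)) ->
  (forall a, #|[set s | tau s == a]%SET| = tnth i a) ->
  (forall tau', (forall a, #|[set s | tau' s == a]%SET| = tnth i a) ->
     \sum_s c (tau s) s <= \sum_s c (tau' s) s) ->
  det_valuation i L = - (\sum_s c (tau s) s + m).
Proof.
move=> e LE tauE opt; set N := \sum_s c (tau s) s.
have maxN : is_maximum (det_values i L) (- (N + m))%:E.
  split=> [|_ [e' [V [LV ->]]]].
    have [|pi hpi] := @same_fibers_perm _ (block_of e) tau.
      by move=> a; rewrite tauE card_block.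
    (* Row [x] is the basis vector of index [pi x], scaled so as to lie in the lattice of its
       block. *)
    pose M := diag_mx (\row_x laurent_monomial F (c (block_of e x) (pi x))) *m
              (perm_mx pi *m X).
    have ME x j : M x j = laurent_monomial F (c (block_of e x) (pi x)) * X (pi x) j.
      by rewrite /M mul_diag_mx -row_permE !mxE.
    have MX : is_order (\det M) (N + m).
      rewrite !det_mulmx det_diag det_perm mulrA; apply: is_order_mul => //.
      rewrite -[N]addr0; apply: is_order_mul; last exact: is_order_sign.
      have -> : N = \sum_x c (block_of e x) (pi x).
        rewrite /N (reindex_inj (@perm_inj _ pi)).
        by apply: eq_bigr => x _; rewrite hpi.
      by apply: is_order_prod => x; rewrite mxE; exact: is_order_monomial.
    exists e, (fun a => submxcol (castmx (esym e, erefl n) M) a); split; last first.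
      by rewrite submxcolK castmxKV (lval_order MX).
    move=> a b; rewrite LE; set x := cast_ord e (tagnat.Rank a b).
    exists (fun s => (s == pi x)%:R).
      by move=> s l l0; case: eqP => _ //; apply: Defs.vge_monomial.
    rewrite (bigD1 (pi x))//= eqxx scale1r [X in _ + X]big1 ?addr0; last first.
      by move=> s /negbTE ->; rewrite scale0r.
    apply/rowP => j; rewrite 2![in LHS]mxE castmxE /= cast_ord_id esymK -/x.
    by rewrite ME !mxE block_of_Rank.
  rewrite (Prop_irrelevance e' e); set A := castmx _ _.
  have Arow x : exists g : 'I_n -> K, (forall s, integral (g s)) /\
      row x A = \sum_s g s *: row s (scaled_basis (c (block_of e x)) X).
    have := LV (block_of e x) (tagnat.sig2 (cast_ord (esym e) x)).
    rewrite LE => -[g g0 gE]; exists g; split=> //; rewrite -gE.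
    by apply/rowP => j; rewrite !mxE castmxE mxE /= cast_ord_id.
  have {Arow}/choice[G hG] := Arow.
  (* The monomials move from the basis into the coordinates, so that the same [X] serves all
     blocks. *)
  pose M := \matrix_(x, s) (G x s * laurent_monomial F (c (block_of e x) s)).
  have -> : A = M *m X.
    apply/row_matrixP => x; rewrite row_mul mulmx_sum_row (hG x).2.
    by apply: eq_bigr => s _; rewrite rowK scalerA !mxE.
  rewrite det_mulmx; apply/Defs.vge_lval/Defs.vge_mul; last first.
    by have /is_orderP[] := X_order.
  apply: Defs.vge_sum => pi _.
  have h : Defs.vge N (\prod_x M x (pi x)).
    apply: (@Defs.vgeW _ (\sum_x c (block_of e x) (pi x))).
      rewrite (reindex_inj (@perm_inj _ (pi^-1)%g)).
      under eq_bigr do rewrite permKV.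
      (* The term of [pi] assigns to [s] the block of the row that uses column [s]; bijectivity of
         [pi] gives the right fiber sizes. *)
      apply: (opt (fun s => block_of e ((pi^-1)%g s))) => a.
      rewrite -(card_block e) -[RHS](card_preimset _ (@perm_inj _ (pi^-1)%g)).
      by apply: eq_card => s; rewrite !inE.
    elim/big_rec2 : _ => [|x y l _ h]; first exact: Defs.vge_monomial.
    apply: Defs.vge_mul => //; rewrite mxE -[X in Defs.vge X _]add0r.
    by apply: Defs.vge_mul ((hG x).1 _) _; exact: Defs.vge_monomial.
  by case: (odd_perm pi); rewrite ?expr1 ?mulN1r ?expr0 ?mul1r//; exact: Defs.vge_opp.
apply: xget_unique => [|l [Al lmax]]; first exact: maxN.
have := maxN.2 _ Al; have := lmax _ maxN.1.
by rewrite !lee_fin => h1 h2; apply/eqP; rewrite eq_le h2.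
Qed.
End Apartment.

(** * Comparison of the cheapest assignment with the lattice [P] *)

Lemma ler_sum_const_card (T : finType) (A B : {set T}) (g : T -> int) (q : int) :
  #|A| = #|B| -> (forall s, s \in A -> g s = q) -> (forall s, s \in B -> q <= g s) ->
  \sum_(s in A) g s <= \sum_(s in B) g s.
Proof.
move=> AB gA gB; rewrite (eq_bigr _ gA) sumr_const AB -sumr_const.
exact: ler_sum.
Qed.


Theorem theorem20 (R : realType) (n k : nat) (hn : (0 < n)%N) (hk : (0 < k)%N)
    (L : k.-tuple (set 'rV[laurent R[i]]_n))
    (hL : forall j : 'I_k, is_lattice (tnth L j))
    (hap : same_apartment L)
    (d : k.-tuple nat) (hd : (\sum_(j < k) tnth d j = n)%N) :
  exists P : set 'rV[laurent R[i]]_n,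
    is_lattice P /\
    det_valuation d L =
      (\sum_(j < k) det_valuation [tuple tnth d j; (n - tnth d j)%N] [tuple tnth L j; P])
      - (k%:Z - 1) * det_valuation [tuple n] [tuple P].
Proof.
have [X fX /choice[c cE]] := hap.
have [m _ Xm] : exists2 m, lval (\det X) = m%:E & is_order (\det X) m.
  by apply: lvalP; rewrite -unitfE -unitmxE -row_free_unit.
pose fibers (f : {ffun 'I_n -> 'I_k}) :=
  [forall a, #|[set s | f s == a]%SET| == tnth d a].
have block_fibers : fibers [ffun s => block_of hd s].
  apply/forallP => a; rewrite -[X in _ == X](card_block hd); apply/eqP/eq_card => s.
  by rewrite !inE ffunE.
have [tau /forallP tauE tau_min] :=
  arg_minP (fun f : {ffun 'I_n -> 'I_k} => \sum_s c (f s) s) block_fibers.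
have {}tauE a : #|[set s | tau s == a]%SET| = tnth d a by apply/eqP.
have {}tau_min f : (forall a, #|[set s | f s == a]%SET| = tnth d a) ->
    \sum_s c (tau s) s <= \sum_s c (f s) s.
  move=> fE; have := tau_min [ffun s => f s].
  under [X in _ <= X]eq_bigr do rewrite ffunE.
  apply; apply/forallP => a; rewrite -fE; apply/eqP/eq_card => s.
  by rewrite !inE ffunE.
have [v vP] : exists v : 'I_n -> int,
    forall s r, c (tau s) s - c (tau r) s <= v r - v s.
  (* Composing [tau] with a permutation preserves its fiber sizes, so minimality of [tau] bounds the
     weights. *)
  apply: potential_exists => [s|pi]; first exact: subrr.
  rewrite sumrB subr_le0; apply: (tau_min (fun s => tau (pi s))) => a.
  rewrite -tauE -[RHS](card_preimset _ (@perm_inj _ pi)).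
  by apply: eq_card => s; rewrite !inE.
pose p s := c (tau s) s + v s.
pose P := integral_span (scaled_basis p X).
exists P; split; first by exists (scaled_basis p X) => //; exact: row_free_scaled_basis.
have dn j : (tnth d j <= n)%N by rewrite -hd (bigD1 j)//= leq_addr.
have valL : det_valuation d L = - (\sum_s c (tau s) s + m).
  exact: (det_valuation_assignment Xm hd cE tauE tau_min).
have valP : det_valuation [tuple n] [tuple P] = - (\sum_s p s + m).
  apply: (@det_valuation_assignment _ _ _ _ Xm _ _ _ (fun=> p) (fun=> ord0)) => //.
  - by rewrite big_ord1.
  - by move=> a; rewrite [a]ord1.
  - move=> a; rewrite [a]ord1 -[RHS]card_ord -cardsT.
    by apply: eq_card => s; rewrite !inE.
have valLP j : det_valuation [tuple tnth d j; (n - tnth d j)%N] [tuple tnth L j; P] =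
    - (\sum_s p s - \sum_(s | tau s == j) v s + m).
  pose c2 (a : 'I_2) s := if a == 0 then c j s else p s.
  (* Relative to taking every index from [P], only the fiber over 0, assigned to [L_j], changes the
     cost. *)
  have costE (f : 'I_n -> 'I_2) : \sum_s c2 (f s) s =
      \sum_s p s + \sum_(s in [set s | f s == 0]%SET) (c j s - p s).
    rewrite [X in _ + X]big_mkcond -big_split; apply: eq_bigr => s _ /=.
    by rewrite /c2 inE; case: eqP => _; rewrite ?addr0// addrC subrK.
  pose tauj s : 'I_2 := if tau s == j then 0 else 1.
  have tauj0 : [set s | tauj s == 0]%SET = [set s | tau s == j]%SET.
    by apply/setP => s; rewrite !inE /tauj; case: (tau s == j).
  rewrite (@det_valuation_assignment _ _ _ _ Xm _ _ _ c2 tauj).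
  - congr (- (_ + _)); rewrite costE tauj0; congr (_ + _).
    rewrite -sumrN; apply: eq_big => s; rewrite inE // => /eqP <-.
    by rewrite /p opprD addrA subrr add0r.
  - by rewrite !big_ord_recl big_ord0 addn0; exact: (subnKC (dn j)).
  - by case=> -[|[|//]] ?; rewrite (tnth_nth set0) /=; [exact: cE|].
  - have card0 : #|[set s | tauj s == 0]%SET| = tnth d j by rewrite tauj0.
    case=> -[|[|//]] lta; rewrite [RHS](tnth_nth 0%N) /=.
      by rewrite -[RHS]card0; apply: eq_card => s; rewrite !inE.
    rewrite cardsCs card_ord -card0; congr (_ - _)%N.
    by apply: eq_card => s; rewrite !inE /tauj; case: (tau s == j).
  - move=> f /(_ 0) f0; rewrite !costE lerD2l tauj0.
    have {}f0 : #|[set s | tau s == j]%SET| = #|[set s | f s == 0]%SET|.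
      by rewrite f0 tauE (tnth_nth 0%N).
    (* An empty fiber offers no [r] for the threshold [- v r] used below. *)
    have [E|[r]] := set_0Vmem [set s | tau s == j]%SET.
      move: f0; rewrite E cards0 => /esym /cards0_eq ->.
      by rewrite !big_set0.
    (* On the fiber of [tau] over [j], the potential inequalities in both directions make [v]
       constant, so [c j s - p s] is [- v r] there; one direction gives at least [- v r] for every
       other [s]. *)
    rewrite inE => /eqP rj; apply: (@ler_sum_const_card _ _ _ _ (- v r)) => // s.
      rewrite inE => /eqP sj; have := vP s r; have := vP r s.
      by rewrite /p rj sj; lia.
    by move=> _; have := vP s r; rewrite /p rj; lia.
rewrite valL valP (eq_bigr _ (fun j _ => valLP j)) sumrN.
rewrite big_split sumrB /= !sumr_const card_ord.
(* The fibers of [tau] partition the indices, so the corrections add up to the full sum of [v],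
   exactly the excess of [p] over the cost of [tau]. *)
have -> : \sum_(j < k) \sum_(s | tau s == j) v s = \sum_s v s.
  by rewrite (partition_big tau predT).
have mulk (x : int) : x *+ k = k%:Z * x by rewrite -mulr_natl natz.
by rewrite /p big_split /= !mulk; ring.
Qed.
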